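(* Let $L\in(0,\infty)$, let $I$ be an index set, and let $x_i\in\mathbb{E}$, $g_i\in\mathbb{E}^*$, $f_i\in\mathbb{R}$ for $i\in I$. The set $\{(x_i,g_i,f_i)\}_{i\in I}$ is $\mathcal{F}_{-L,L}$-interpolable (interpolable by an $L$-smooth, not necessarily convex, function) if and only if for all $i,j\in I$ $$f_i\geq f_j-\frac{L}{4}\|x_i-x_j\|_{\mathbb{E}}^2-\frac12\langle g_i+g_j,x_j-x_i\rangle+\frac{1}{4L}\|g_i-g_j\|_{\mathbb{E}^*}^2.$$
   Context: $\mathbb{E}$ is a finite-dimensional real vector space with dual $\mathbb{E}^*$, $\langle\cdot,\cdot\rangle:\mathbb{E}^*\times\mathbb{E}\to\mathbb{R}$ is a dual pairing (nondegenerate bilinear map), $B:\mathbb{E}\to\mathbb{E}^*$ is a self-adjoint positive definite linear operator, $\|x\|_{\mathbb{E}}^2=\langle Bx,x\rangle$ for $x\in\mathbb{E}$ and $\|s\|_{\mathbb{E}^*}^2=\langle s,B^{-1}s\rangle$ for $s\in\mathbb{E}^*$. $\mathcal{F}_{-L,L}(\mathbb{E})$ is the set of ($L$-smooth) differentiable functions $f$ on $\mathbb{E}$ such that $\big|f(x)+\langle\nabla f(x),y-x\rangle-f(y)\big|\leq\frac{L}{2}\|x-y\|_{\mathbb{E}}^2$ for all $x,y\in\mathbb{E}$ (gradients $\nabla f(x)\in\mathbb{E}^*$ are taken with respect to the pairing). The set $\{(x_i,g_i,f_i)\}_{i\in I}$ is $\mathcal{F}_{-L,L}$-interpolable if there exists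 $f\in\mathcal{F}_{-L,L}(\mathbb{E})$ such that $\nabla f(x_i)=g_i$ and $f(x_i)=f_i$ for all $i\in I$. *)

(* Defs.v *)
From HB Require Import structures.
From mathcomp Require Import all_boot all_order all_algebra.
From mathcomp Require Import all_classical all_reals all_analysis.
From mathcomp Require Import lra.
Set Implicit Arguments.
Unset Strict Implicit.
Unset Printing Implicit Defensive.
Import Order.TTheory GRing.Theory Num.Theory.
Import numFieldNormedType.Exports.
Local Open Scope classical_set_scope.
Local Open Scope ring_scope.

Notation pairing Es E := {bilinear Es -> E -> _ | *%R & *%R}.

Definition nondegenerate_pairing (R : realType) (E Es : vectType R)
    (p : pairing Es E) : Prop :=
  (forall s : Es, (forall x : E, p s x = 0) -> s = 0) /\
  (forall x : E, (forall s : Es, p s x = 0) -> x = 0).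

Record spd_operator (R : realType) (E Es : vectType R) (p : pairing Es E) :=
  SpdOperator {
    spd_map :> 'Hom(E, Es) ;
    spd_selfadjoint : forall x y : E, p (spd_map x) y = p (spd_map y) x ;
    spd_posdef : forall x : E, x != 0 -> 0 < p (spd_map x) x }.

(* An alias of E carrying the topology of primal_norm; E has finite dimension,
   so differentiability on it does not depend on the choice of the norm. *)
Definition normed_by (R : realType) (E Es : vectType R) (p : pairing Es E)
  (B : spd_operator p) : Type := E.

Section norms.
Context (R : realType) (E Es : vectType R) (p : pairing Es E).
Variable B : spd_operator p.

Definition primal_norm (x : E) : R := Num.sqrt (p (B x) x).

(* For a general B, (B^-1)%VF is only a right inverse on the range of B; here,
   if p is nondegenerate, it is the inverse of B (spd_invK and spd_mapK). *)
Definition dual_norm (s : Es) : R := Num.sqrt (p s ((B^-1)%VF s)).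

Lemma spd_ge0 (x : E) : 0 <= p (B x) x.
Proof.
have [->|/(spd_posdef B)/ltW//] := eqVneq x 0.
by rewrite linear0r.
Qed.

Lemma primal_norm_sqr (x : E) : primal_norm x ^+ 2 = p (B x) x.
Proof. by rewrite sqr_sqrtr// spd_ge0. Qed.

Lemma spd_formD (x y : E) :
  p (B (x + y)) (x + y) = p (B x) x + 2 * p (B x) y + p (B y) y.
Proof.
rewrite linearDr/= [B (x + y)]linearD !linearDl/= (spd_selfadjoint B y x); lra.
Qed.

Lemma spd_formZ (a : R) (x y : E) : p (B (a *: x)) y = a * p (B x) y.
Proof. by rewrite linearZ/= linearZl_LR. Qed.

Lemma pairing_scaler (a : R) (u : Es) (y : E) : p u (a *: y) = a * p u y.
Proof. exact: linearZr. Qed.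

Lemma spd_schwarz (x y : E) : p (B x) y <= primal_norm x * primal_norm y.
Proof.
rewrite /primal_norm -sqrtrM ?spd_ge0//.
apply: le_trans (ler_norm _) _; rewrite -sqrtr_sqr; apply: ler_wsqrtr.
have [->|x0] := eqVneq x 0.
  by rewrite (linear0 B) !linear0l expr0n.
have := spd_ge0 (- p (B x) y *: x + p (B x) x *: y).
rewrite spd_formD !spd_formZ !pairing_scaler.
have := spd_posdef B x0.
move: (p (B x) x) (p (B x) y) (p (B y) y) => a b c a0 h.
by rewrite -subr_ge0 -(pmulr_rge0 _ a0); lra.
Qed.

Lemma primal_norm_triangle (x y : E) :
  primal_norm (x + y) <= primal_norm x + primal_norm y.
Proof.
rewrite -(@ler_pXn2r _ 2)// ?nnegrE ?addr_ge0 ?sqrtr_ge0//.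
rewrite primal_norm_sqr spd_formD sqrrD !primal_norm_sqr.
have := spd_schwarz x y; lra.
Qed.

Lemma primal_normZ (a : R) (x : E) :
  primal_norm (a *: x) = `|a| * primal_norm x.
Proof.
rewrite /primal_norm spd_formZ pairing_scaler mulrA -expr2.
by rewrite sqrtrM ?sqr_ge0// sqrtr_sqr.
Qed.

Lemma primal_norm_eq0 (x : E) : primal_norm x = 0 -> x = 0.
Proof.
move=> x0; apply/eqP; apply: contraT => /(spd_posdef B).
by rewrite -primal_norm_sqr x0 expr0n ltxx.
Qed.

HB.instance Definition _ := Vector.copy (normed_by B) E.
HB.instance Definition _ := Lmodule_isNormed.Build R (normed_by B)
  primal_norm_triangle primal_normZ primal_norm_eq0.

(* The Riesz representative with respect to p of the Frechet differential. *)
Definition gradient (f : normed_by B -> R) (x : normed_by B) : Es :=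
  xget 0 [set g : Es | forall h : normed_by B, 'd f x h = p g h].

Definition smooth_class (L : R) : set (normed_by B -> R) :=
  [set f | (forall x : normed_by B, differentiable f x) /\
    forall x y : normed_by B,
      `|f x + p (gradient f x) (y - x) - f y| <=
        L / 2 * primal_norm (x - y) ^+ 2].

Definition interpolable (L : R) (I : Type)
    (x : I -> E) (g : I -> Es) (f : I -> R) : Prop :=
  exists2 F : normed_by B -> R, smooth_class L F &
    forall i : I, gradient F (x i) = g i /\ F (x i) = f i.

Section nondegenerate.
Hypothesis p_nondeg : nondegenerate_pairing p.

Definition pairing_fun (s : Es) : E -> R^o := p s.

Lemma pairing_fun_linear s : linear (pairing_fun s).
Proof. by move=> a x y; rewrite /pairing_fun linearDr/= linearZr. Qed.

HB.instance Definition _ s :=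
  GRing.isLinear.Build R E R^o _ (pairing_fun s) (pairing_fun_linear s).

Definition pairing_hom (s : Es) : 'Hom(E, R^o) := linfun (pairing_fun s).

Lemma pairing_hom_linear : linear pairing_hom.
Proof.
move=> a s t; apply/lfunP => x; rewrite add_lfunE scale_lfunE !lfunE/=.
by rewrite /pairing_fun linearDl/= linearZl_LR.
Qed.

HB.instance Definition _ :=
  GRing.isLinear.Build R Es 'Hom(E, R^o) _ pairing_hom pairing_hom_linear.

Lemma lker_pairing_hom : lker (linfun pairing_hom) = 0%VS.
Proof.
apply/eqP; rewrite -subv0; apply/subvP => s; rewrite memv_ker memv0 lfunE/=.
move=> /eqP evs; apply/eqP/p_nondeg.1 => x.
by have := congr1 (fun u : 'Hom(E, R^o) => u x) evs; rewrite lfunE/= lfunE.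
Qed.

Lemma lker_spd : lker B = 0%VS.
Proof.
apply/eqP; rewrite -subv0; apply/subvP => x; rewrite memv_ker memv0 => /eqP Bx0.
by apply: contraT => /(spd_posdef B); rewrite Bx0 linear0l ltxx.
Qed.

Lemma pairing_dim : \dim {:E} = \dim {:Es}.
Proof.
apply/eqP; rewrite eqn_leq; apply/andP; split.
  have := limg_ker_dim B fullv; rewrite lker_spd capv0 dimv0 add0n => <-.
  exact: dimvS (subvf _).
have := limg_ker_dim (linfun pairing_hom) fullv.
rewrite lker_pairing_hom capv0 dimv0 add0n => <-.
apply: leq_trans (dimvS (subvf _)) _.
by rewrite !dimvf /dim/= muln1.
Qed.

Lemma limg_spd : limg B = fullv.
Proof.
apply/eqP; rewrite eqEdim subvf/=.
have := limg_ker_dim B fullv.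
by rewrite lker_spd capv0 dimv0 add0n pairing_dim => ->.
Qed.

Lemma spd_invK : cancel B (B^-1)%VF.
Proof. by move=> x; apply: lker0_lfunK; rewrite lker_spd. Qed.

Lemma spd_mapK : cancel (B^-1)%VF B.
Proof. by move=> s; apply: limg_lfunVK; rewrite limg_spd memvf. Qed.

Lemma gradientE (f : normed_by B -> R) (x h : normed_by B) :
  'd f x h = p (gradient f x) h.
Proof.
rewrite /gradient; case: xgetP => [g _ /(_ h)//|/=].
have : linfun ('d f x : E -> R^o) \in limg (linfun pairing_hom).
  suff -> : limg (linfun pairing_hom) = fullv by rewrite memvf.
  apply/eqP; rewrite eqEdim subvf/=.
  have := limg_ker_dim (linfun pairing_hom) fullv.
  rewrite lker_pairing_hom capv0 dimv0 add0n -pairing_dim => ->.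
  by rewrite !dimvf /dim/= muln1.
move=> /memv_imgP[s _ sE] /(_ s) []/= k.
have := congr1 (fun u : 'Hom(E, R^o) => u k) sE.
by rewrite lfunE/= lfunE/= lfunE.
Qed.

Lemma gradient_unique (f : normed_by B -> R) (x : normed_by B) (g : Es) :
  (forall h : normed_by B, 'd f x h = p g h) -> gradient f x = g.
Proof.
move=> fg; apply/eqP; rewrite -subr_eq0; apply/eqP/p_nondeg.1 => h.
by rewrite linearBl/= -gradientE fg subrr.
Qed.
End nondegenerate.
End norms.

(* Main.v *)
Require Import Defs.
From HB Require Import structures.
From mathcomp Require Import all_boot all_order all_algebra.
From mathcomp Require Import all_classical all_reals all_analysis.
From mathcomp Require Import ring lra.
Import Order.TTheory GRing.Theory Num.Theory.
Import numFieldNormedType.Exports.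
Local Open Scope ring_scope.

(** Completing the square in z, the inequality for (i, j) says exactly that the
    paraboloid f_j + <g_j, z - x_j> - L/2 |z - x_j|^2 lies below the paraboloid
    f_i + <g_i, z - x_i> + L/2 |z - x_i|^2 for every z, and an interpolant lies
    between the two. Conversely, let F be the supremum of all psi such that
    psi + L/2 |.|^2 is convex and psi lies below all the upper paraboloids. The
    lower paraboloids are such functions, so F interpolates the values. The
    average (F(. + v) + F(. - v))/2 - L/2 |v|^2 is again such a function, so
    that F(y + v) + F(y - v) - 2 F(y) <= L |v|^2. Hence the one-sided
    directional derivatives of the convex function F + L/2 |.|^2 are linear in
    the direction, and they provide the gradient of F. *)

(** Passage to the limit as [t] tends to 0 from above, with an error linear in [t]. *)
Lemma ler_add_small (R : realFieldType) (a b c : R) :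
  (forall t, 0 < t -> a <= b + t * c) -> a <= b.
Proof.
move=> abt; apply/ler_addgt0Pr => e e0.
have c1 : 0 < `|c| + 1 by rewrite ltr_pwDr.
apply: le_trans (abt _ (divr_gt0 e0 c1)) _; rewrite lerD2l -mulrA ger_pMr//.
by rewrite mulrC ler_pdivrMr// mul1r (le_trans (ler_norm c))// lerDl.
Qed.

(** * Tangents of convex functions with bounded second differences *)

Section tangent.
Context (R : realType) (V : lmodType R) (N k : V -> R) (L : R).
Hypothesis N_homog : forall t v, N (t *: v) = t ^+ 2 * N v.
Hypothesis k_convex : forall x v t, 0 <= t <= 1 ->
  k (x + t *: v) <= (1 - t) * k x + t * k (x + v).
Hypothesis k0 : k 0 = 0.
Hypothesis L_ge0 : 0 <= L.
Hypothesis N_ge0 : forall v, 0 <= N v.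
Hypothesis k_second_difference : forall x v,
  k (x + v) + k (x - v) - 2 * k x <= 2 * L * N v.

(* By convexity, the right derivative of [k] at [0] in the direction [v]. *)
Let D (v : V) : R := inf [set k (t *: v) / t | t in [set t | 0 < t]]%classic.

(** The origin is the combination of [- t *: v] and [s *: v] with weights [s / (s + t)] and
    [t / (s + t)]. Backward slopes thus bound the forward ones from below, which makes the infimum
    [D v] finite. *)
Lemma convex_slope_opp v s t : 0 < s -> 0 < t ->
  - (k (- t *: v) / t) <= k (s *: v) / s.
Proof.
move=> s0 t0; have st0 : 0 < s + t by rewrite addr_gt0.
have t01 : 0 <= t / (s + t) <= 1.
  by rewrite (divr_ge0 (ltW t0) (ltW st0))//= ler_pdivrMr// mul1r lerDr ltW.
have := k_convex (- t *: v) ((s + t) *: v) _ t01.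
rewrite scalerA divfK ?gt_eqF// scaleNr addNr k0 -scaleNr -scalerDl.
rewrite (_ : - t + (s + t) = s); last by ring.
rewrite (_ : 1 - t / (s + t) = s / (s + t)); last by field; rewrite gt_eqF.
set a := k (- t *: v); set b := k (s *: v) => ab.
have : 0 <= (s / (s + t) * a + t / (s + t) * b) * (s + t) / (s * t).
  apply: divr_ge0; last by rewrite ltW// mulr_gt0.
  by apply: mulr_ge0 => //; exact: ltW.
suff -> : (s / (s + t) * a + t / (s + t) * b) * (s + t) / (s * t) =
  a / t + b / s by lra.
by field; rewrite !gt_eqF.
Qed.

Lemma tangent_le v t : 0 < t -> t * D v <= k (t *: v).
Proof.
move=> t0; rewrite mulrC -ler_pdivlMr//; apply: ge_inf; last by exists t.
by exists (- (k (- 1 *: v) / 1)) => _ [s s0 <-]; exact: convex_slope_opp.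
Qed.

Lemma tangent_ge v t : 0 < t -> k (t *: v) <= t * D v + t ^+ 2 * (2 * L * N v).
Proof.
move=> t0; have : - (k (- t *: v) / t) <= D v.
  apply: lb_le_inf; first by exists (k (1 *: v) / 1), 1 => //=.
  by move=> _ [s s0 <-]; exact: convex_slope_opp.
rewrite -mulNr ler_pdivrMr// mulrC => Dv.
have := k_second_difference 0 (t *: v).
rewrite !add0r k0 mulr0 subr0 N_homog -scaleNr; lra.
Qed.

Lemma tangentD_le v w : D (v + w) <= D v + D w.
Proof.
apply: (@ler_add_small _ _ _ (4 * L * (N v + N w))) => t t0.
rewrite -(ler_pM2l t0); apply: le_trans (tangent_le (v + w) t t0) _.
have half01 : 0 <= (2^-1 : R) <= 1 by apply/andP; split; lra.
(* [t *: (v + w)] is the midpoint of [(2 * t) *: v] and [(2 * t) *: w]. *)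
have := k_convex ((2 * t) *: w) ((2 * t) *: v - (2 * t) *: w) _ half01.
have -> : (2 * t) *: w + 2^-1 *: ((2 * t) *: v - (2 * t) *: w) = t *: (v + w).
  rewrite scalerBr !scalerA mulKf ?pnatr_eq0// (mulr_natl t 2) mulr2n scalerDl.
  by rewrite addrACA subrr addr0 addrC scalerDr.
rewrite subrKC.
have t2 : 0 < 2 * t by rewrite mulr_gt0.
have := tangent_ge v _ t2; have := tangent_ge w _ t2; lra.
Qed.

Lemma tangent0 : D 0 = 0.
Proof.
have N0 : N 0 = 0 by have := N_homog 0 0; rewrite scaler0 expr0n mul0r.
have := tangent_ge 0 _ ltr01; have := tangent_le 0 _ ltr01.
rewrite scaler0 N0 k0; lra.
Qed.

Lemma tangentN v : D (- v) = - D v.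
Proof.
apply/eqP; rewrite -addr_eq0 eq_le; apply/andP; split; last first.
  by rewrite -tangent0 -(addNr v) tangentD_le.
apply: (@ler_add_small _ _ _ (2 * L * N v)) => t t0.
rewrite -(ler_pM2l t0) add0r.
have := tangent_le v _ t0; have := tangent_le (- v) _ t0.
have := k_second_difference 0 (t *: v).
rewrite !add0r k0 mulr0 subr0 N_homog scalerN; lra.
Qed.

Lemma tangentD v w : D (v + w) = D v + D w.
Proof.
apply/eqP; rewrite eq_le tangentD_le/=.
have := tangentD_le (v + w) (- w); rewrite addrK tangentN; lra.
Qed.

Lemma tangentZ_ge a v : 0 < a -> a * D v <= D (a *: v).
Proof.
move=> a0; apply: (@ler_add_small _ _ _ (2 * L * N (a *: v))) => t t0.
rewrite -(ler_pM2l t0) mulrA.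
apply: le_trans (tangent_le v _ (mulr_gt0 t0 a0)) _.
by rewrite -scalerA mulrDr mulrA -expr2 tangent_ge.
Qed.

Lemma tangentZ_gt0 a v : 0 < a -> D (a *: v) = a * D v.
Proof.
move=> a0; apply/eqP; rewrite eq_le tangentZ_ge// andbT.
rewrite -ler_pdivrMl//; have ai : 0 < a^-1 by rewrite invr_gt0.
apply: le_trans (tangentZ_ge _ _ ai) _.
by rewrite scalerA mulVf ?gt_eqF// scale1r.
Qed.

Lemma tangentZ a v : D (a *: v) = a * D v.
Proof.
have [a0|a0|->] := ltgtP a 0; last 1 first.
- by rewrite scale0r mul0r tangent0.
- rewrite -[a]opprK scaleNr tangentN tangentZ_gt0 ?oppr_gt0//; ring.
- exact: tangentZ_gt0.
Qed.

Lemma le_double v : k v <= 2 * k (2^-1 *: v) + L / 2 * N v.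
Proof.
have := k_second_difference (2^-1 *: v) (2^-1 *: v).
rewrite subrr k0 -scalerDl N_homog (_ : 2^-1 + 2^-1 = 1 :> R); last by field.
rewrite scale1r exprVn; lra.
Qed.

(* Iterating [le_double] sharpens the constant [2 * L] of [tangent_ge] to [L]. *)
Lemma tangent_ge_iter n v :
  k v <= D v + L * N v + (2^-1) ^+ n * (L * N v).
Proof.
elim: n v => [|n IH] v.
  have := tangent_ge v _ ltr01; rewrite scale1r expr0; lra.
(* At [v / 2] both quadratic terms are quartered. Doubling leaves [L / 2 * N v], to which
   [le_double] adds the other half, while the remainder ends up halved. *)
have := IH (2^-1 *: v); rewrite N_homog tangentZ => IHv.
have := le_double v.
rewrite -mulrA; set c := 2^-1 ^+ n * (L * N v).
have cE : 2^-1 ^+ n * (L * (2^-1 ^+ 2 * N v)) = 2^-1 ^+ 2 * c.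
  by rewrite /c; ring.
move: IHv; rewrite cE (exprS _ n) -(mulrA 2^-1) -/c; lra.
Qed.

Lemma smooth_convex_tangent :
  exists2 l : V -> R^o, linear l & forall v, 0 <= k v - l v <= L * N v.
Proof.
exists D => [a u w|v]; first by rewrite tangentD tangentZ.
apply/andP; split.
  by have := tangent_le v _ ltr01; rewrite scale1r; lra.
rewrite lerBlDl; apply: (@ler_add_small _ _ _ (L * N v)) => t t0.
pose n := Num.bound t^-1.
apply: le_trans (tangent_ge_iter n v) _.
rewrite lerD2l; apply: ler_wpM2r; first by rewrite mulr_ge0.
rewrite exprVn invf_ple ?posrE ?exprn_gt0//.
exact/ltW/upper_nthrootP.
Qed.
End tangent.

(** * Riesz representation and differentiability from a quadratic error *)

Section differentiability.
Context {R : realType} {E Es : vectType R} {p : pairing Es E}.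
Hypothesis p_nondeg : nondegenerate_pairing p.
Variable B : spd_operator p.

(** Nondegeneracy makes [pairing_hom] injective, and [B] forces [E] and [Es] to have equal
    dimension, so it is also onto the dual. *)
Lemma pairing_riesz (f : E -> R^o) : linear f ->
  exists s : Es, forall x, p s x = f x.
Proof.
move=> f_linear.
pose l : {linear E -> R^o} :=
  HB.pack f (GRing.isLinear.Build R E R^o _ f f_linear).
have : linfun l \in limg (linfun (pairing_hom p)).
  suff -> : limg (linfun (pairing_hom p)) = fullv by rewrite memvf.
  apply/eqP; rewrite eqEdim subvf/=.
  have := limg_ker_dim (linfun (pairing_hom p)) fullv.
  rewrite lker_pairing_hom// capv0 dimv0 add0n -(pairing_dim B)// => ->.
  by rewrite !dimvf /dim/= muln1.
move=> /memv_imgP[s _ sE]; exists s => x.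
have := congr1 (fun u : 'Hom(E, R^o) => u x) sE.
by rewrite lfunE/= lfunE/= lfunE.
Qed.

Lemma pairing_continuous (s : Es) :
  continuous (pairing_fun p s : normed_by B -> R^o).
Proof.
apply/(linear_bounded_continuous
  (pairing_fun p s : {linear normed_by B -> R^o})).
apply/bounded_funP => r; exists (primal_norm B ((B^-1)%VF s) * r) => x xr.
rewrite /pairing_fun/=.
have bnd y : p s y <= primal_norm B ((B^-1)%VF s) * primal_norm B y.
  by rewrite -{1}(spd_mapK B p_nondeg s) spd_schwarz.
apply: (@le_trans _ _ (primal_norm B ((B^-1)%VF s) * primal_norm B x)).
  rewrite ler_norml bnd andbT lerNl.
  have := bnd (-1 *: x).
  by rewrite pairing_scaler mulN1r primal_normZ normrN1 mul1r.
by apply: ler_wpM2l => //; rewrite sqrtr_ge0.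
Qed.

Lemma differentiable_quadratic (F : normed_by B -> R) (x : normed_by B)
    (s : Es) (C : R) :
  (forall h : E, `|F (x + h) - F x - p s h| <= C * primal_norm B h ^+ 2) ->
  differentiable F x /\ gradient F x = s.
Proof.
move=> Fs.
pose ps : normed_by B -> R^o := pairing_fun p s.
have expansion : F \o shift x = cst (F x) + ps +o_ 0 id.
  apply/eqaddoP => _/posnumP[e]; near=> h.
  apply: le_trans (_ : C * primal_norm B h ^+ 2 <= _).
    rewrite -[_ h]/(F (h + x) - (F x + p s h)).
    by rewrite opprD addrA (addrC h); exact: Fs.
  (* The sign of [C] is unknown; [|C| + 1] is a positive bound to divide by. *)
  have C1 : 0 < `|C| + 1 by rewrite ltr_pwDr.
  have hC : primal_norm B h <= e%:num / (`|C| + 1).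
    by near: h; apply: nbhs0_le; rewrite divr_gt0.
  rewrite expr2 mulrA; apply: ler_wpM2r; first exact: sqrtr_ge0.
  apply: le_trans (_ : (`|C| + 1) * primal_norm B h <= _).
    apply: ler_wpM2r; first exact: sqrtr_ge0.
    by rewrite (le_trans (ler_norm C))// lerDl.
  by rewrite mulrC -ler_pdivlMr.
have dF := diff_unique (pairing_continuous s) expansion.
split.
  apply/diff_locallyP; rewrite dF; split => //; exact: pairing_continuous.
by apply: gradient_unique => // h; rewrite dF.
Unshelve. all: by end_near. Qed.
End differentiability.

(** * Paraboloids and semiconvexity *)

Section parabola.
Context {R : realType} {E Es : vectType R} {p : pairing Es E}.
Variable B : spd_operator p.
Local Notation N x := (p (B x) x).

Lemma pairingDr s y z : p s (y + z) = p s y + p s z.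
Proof. exact: linearDr. Qed.

Lemma pairingDl s s' y : p (s + s') y = p s y + p s' y.
Proof. exact: linearDl. Qed.

Lemma spd_formDZ (x v : E) (t : R) :
  N (x + t *: v) = N x + 2 * t * p (B x) v + t ^+ 2 * N v.
Proof.
(* [p] is given explicitly because the product of [R] is also a pairing. *)
rewrite spd_formD spd_formZ !(pairing_scaler p).
move: (N x) (p (B x) v) (N v) => a b c; ring.
Qed.

Definition parabola (c : R) (a : E) (s : Es) (b : R) (y : E) : R :=
  b + p s (y - a) + c / 2 * N (y - a).

Lemma parabolaDZ c a s b y v t :
  parabola c a s b (y + t *: v) =
  (1 - t) * parabola c a s b y + t * parabola c a s b (y + v)
  - c / 2 * (t * (1 - t)) * N v.
Proof.
rewrite /parabola !(addrAC y _ (- a)); move: (y - a) => e.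
rewrite spd_formDZ spd_formD !pairingDr (pairing_scaler p).
move: (p s e) (p s v) (N e) (p (B e) v) (N v) => q r u w n.
by field.
Qed.

Lemma parabola_midpoint c a s b y v :
  parabola c a s b (y + v) + parabola c a s b (y - v) =
  2 * parabola c a s b y + c * N v.
Proof.
(* [parabolaDZ] is an identity in [t], used here outside the unit interval at [t = -1]. *)
rewrite -[- v]scaleN1r parabolaDZ.
by move: (N v) (parabola c a s b y) (parabola c a s b (y + v)) => n q r; field.
Qed.

(* The minimum over [z] of the gap between the two parabolas is the slack in
   the interpolation inequality. *)
Lemma parabola_gap (L : R) a s b a' s' b' w z : L != 0 -> B w = s - s' ->
  parabola L a s b z - parabola (- L) a' s' b' z =
  b - b' + L / 4 * N (a - a') + 1 / 2 * p (s + s') (a' - a)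
  - 1 / (4 * L) * N w
  + L * N (z - 2^-1 *: (a + a') + (2 * L)^-1 *: w).
Proof.
move=> L0 Bw.
(* Centring at the midpoint of the vertices gives [z - a = e - u] and [z - a' = e + u]. *)
pose u := 2^-1 *: (a - a'); pose e := z - 2^-1 *: (a + a').
have half (c : E) : c = 2^-1 *: (c + c).
  by rewrite -mulr2n -(scaler_nat 2 c) scalerA mulVf ?pnatr_eq0// scale1r.
have aE : a = 2^-1 *: (a + a') + u.
  by rewrite /u -scalerDr addrACA subrr addr0 -half.
have a'E : a' = 2^-1 *: (a + a') - u.
  by rewrite /u -scalerBr opprB (addrC a a') addrACA subrr addr0 -half.
have za : z - a = e + -1 *: u by rewrite {1}aE opprD addrA scaleN1r.
have za' : z - a' = e + u by rewrite {1}a'E opprB addrA addrAC.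
have aa' : a - a' = 2 *: u by rewrite /u scalerA mulfV ?pnatr_eq0// scale1r.
have a'a : a' - a = - 2 *: u by rewrite scaleNr -aa' opprB.
have sE : s = s' + B w by rewrite Bw subrKC.
rewrite /parabola za za' aa' a'a -/e; clearbody u e.
rewrite !spd_formDZ spd_formD !spd_formZ.
rewrite !(pairing_scaler p) !pairingDr !(pairing_scaler p) sE !pairingDl.
rewrite (spd_selfadjoint B w e).
move: (p (B e) w) (p (B e) u) (p (B w) u) => b1 b2 b3.
move: (p s' e) (p s' u) (N e) (N u) (N w) => b4 b5 b6 b7 b8.
by field.
Qed.

Hypothesis p_nondeg : nondegenerate_pairing p.

Lemma parabola_leP (L : R) a s b a' s' b' : 0 < L ->
  (forall z, parabola (- L) a' s' b' z <= parabola L a s b z) <->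
  b >= b' - L / 4 * primal_norm B (a - a') ^+ 2
       - 1 / 2 * p (s + s') (a' - a)
       + 1 / (4 * L) * dual_norm B (s - s') ^+ 2.
Proof.
move=> L0; set w := (B^-1)%VF (s - s').
have Bw : B w = s - s' by rewrite spd_mapK.
have -> : dual_norm B (s - s') ^+ 2 = N w.
  by rewrite /dual_norm -/w -Bw sqr_sqrtr// spd_ge0.
have gap z := parabola_gap L a s b a' s' b' w z (lt0r_neq0 L0) Bw.
rewrite primal_norm_sqr; split => [h|h z].
  (* This [z] minimizes the gap: it makes the last square of [parabola_gap] vanish. *)
  have := h (2^-1 *: (a + a') - (2 * L)^-1 *: w).
  rewrite -subr_ge0 gap (addrAC (2^-1 *: _)) subrr add0r addNr linear0r mulr0.
  move: (N (a - a')) (p (s + s') (a' - a)) (N w) => n q r; lra.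
rewrite -subr_ge0 gap; move: (z - _ + _) => e.
have := mulr_ge0 (ltW L0) (spd_ge0 B e); move: h.
move: (N (a - a')) (p (s + s') (a' - a)) (N w) (L * N e) => n q r u; lra.
Qed.

(** This is convexity of [f + L / 2 * N]: the last term is the amount by which the quadratic part
    lies below its chord. *)
Definition semiconvex (L : R) (f : E -> R) := forall y v t, 0 <= t <= 1 ->
  f (y + t *: v) <=
  (1 - t) * f y + t * f (y + v) + L / 2 * (t * (1 - t)) * N v.

Lemma semiconvex_parabola L a s b : semiconvex L (parabola (- L) a s b).
Proof. move=> y v t _; rewrite parabolaDZ; lra. Qed.

Lemma semiconvex_midpoint L f v : semiconvex L f ->
  semiconvex L (fun y => (f (y + v) + f (y - v)) / 2 - L / 2 * N v).
Proof.
move=> cf y w t t01; rewrite !(addrAC y _ v) !(addrAC y _ (- v)).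
have := cf (y + v) w _ t01; have := cf (y - v) w _ t01; lra.
Qed.

(** * The largest semiconvex minorant of the upper paraboloids *)

Section envelope.
Context {I : Type} (L : R) (x : I -> E) (g : I -> Es) (f : I -> R) (i0 : I).
Hypothesis lower_le_upper : forall i j z,
  parabola (- L) (x j) (g j) (f j) z <= parabola L (x i) (g i) (f i) z.

Definition admissible : set (E -> R) := [set psi |
  semiconvex L psi /\
  forall i z, psi z <= parabola L (x i) (g i) (f i) z]%classic.

(** The supremum is a genuine one: the upper paraboloid of [i0] bounds the set, and its lower one
    belongs to [admissible]. *)
Definition envelope (z : E) : R := sup [set psi z | psi in admissible]%classic.

Lemma lower_admissible j : admissible (parabola (- L) (x j) (g j) (f j)).
Proof. by split => //; exact: semiconvex_parabola. Qed.

Lemma le_envelope psi z : admissible psi -> psi z <= envelope z.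
Proof.
move=> psiA; apply: ub_le_sup; last by exists psi.
by exists (parabola L (x i0) (g i0) (f i0) z) => _ [phi [_ phiU] <-].
Qed.

Lemma envelope_le z b :
  (forall psi, admissible psi -> psi z <= b) -> envelope z <= b.
Proof.
move=> zb; apply: ge_sup; last by move=> _ [psi psiA <-]; exact: zb.
pose lower := parabola (- L) (x i0) (g i0) (f i0).
by exists (lower z), lower => //; exact: lower_admissible.
Qed.

Lemma envelope_semiconvex : semiconvex L envelope.
Proof.
move=> y v t /[dup] t01 /andP[t0 t1]; apply: envelope_le => psi psiA.
apply: le_trans (psiA.1 y v t t01) _; rewrite lerD2r.
by apply: lerD; apply: ler_wpM2l; rewrite ?subr_ge0//; exact: le_envelope.
Qed.

(* The midpoint average of the envelope is again admissible, hence lies below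
   the envelope: this is where the upper bound on the curvature comes from. *)
Lemma envelope_second_difference y v :
  envelope (y + v) + envelope (y - v) - 2 * envelope y <= L * N v.
Proof.
set psi := fun y => (envelope (y + v) + envelope (y - v)) / 2 - L / 2 * N v.
suff : admissible psi by move=> /(le_envelope _ y); rewrite /psi; lra.
split=> [|i z]; first exact: semiconvex_midpoint envelope_semiconvex.
have envU u : envelope u <= parabola L (x i) (g i) (f i) u.
  by apply: envelope_le => phi [].
have := parabola_midpoint L (x i) (g i) (f i) z v.
rewrite /psi; have := envU (z + v); have := envU (z - v); lra.
Qed.
End envelope.
End parabola.

(** * From curvature bounds to smooth interpolants *)

Section smooth.
Context {R : realType} {E Es : vectType R} {p : pairing Es E}.
Hypothesis p_nondeg : nondegenerate_pairing p.
Variable B : spd_operator p.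
Local Notation N x := (p (B x) x).

Lemma semiconvex_smooth (L : R) (F : E -> R) : 0 <= L -> semiconvex B L F ->
  (forall y v, F (y + v) + F (y - v) - 2 * F y <= L * N v) ->
  forall x, exists s : Es, forall h,
    `|F (x + h) - F x - p s h| <= L / 2 * primal_norm B h ^+ 2.
Proof.
move=> L0 Fconv Fdiff x.
(* The added quadratic makes [k] convex and raises the bound on second differences from [L * N v] to
   [2 * L * N v]. *)
pose k h := F (x + h) - F x + L / 2 * N h.
have N_homog t v : N (t *: v) = t ^+ 2 * N v.
  by rewrite spd_formZ pairing_scaler mulrA -expr2.
have k_convex y v t : 0 <= t <= 1 ->
    k (y + t *: v) <= (1 - t) * k y + t * k (y + v).
  move=> t01; have := Fconv (x + y) v t t01.
  rewrite /k spd_formDZ spd_formD !addrA.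
  move: (F (x + y + t *: v)) (F (x + y)) (F (x + y + v)) (F x) => f1 f2 f3 f4.
  move: (N y) (N v) (p (B y) v) => n q r; lra.
have k0 : k 0 = 0 by rewrite /k addr0 subrr linear0r mulr0 addr0.
have k_diff y v : k (y + v) + k (y - v) - 2 * k y <= 2 * L * N v.
  have := Fdiff (x + y) v.
  have Ny : N (y - v) = N y + 2 * -1 * p (B y) v + (-1) ^+ 2 * N v.
    by rewrite -scaleN1r spd_formDZ.
  rewrite /k Ny spd_formD !addrA.
  move: (F (x + y - v)) (F (x + y)) (F (x + y + v)) (F x) => f1 f2 f3 f4.
  move: (N y) (N v) (p (B y) v) => n q r; lra.
have [l l_lin lk] := smooth_convex_tangent _ _ _ k _ N_homog k_convex k0 L0
  (spd_ge0 B) k_diff.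
have [s sl] := pairing_riesz p_nondeg B l l_lin; exists s => h.
(* Removing [L / 2 * N h] turns the range from 0 to [L * N h] into a symmetric one. *)
have := lk h; rewrite -sl /k primal_norm_sqr.
move: (F (x + h)) (F x) (N h) (p s h) => f1 f2 n q /andP[? ?].
by rewrite ler_norml; apply/andP; split; lra.
Qed.

Lemma primal_normB y z : primal_norm B (y - z) = primal_norm B (z - y).
Proof. by rewrite -[y - z]opprB -scaleN1r primal_normZ normrN1 mul1r. Qed.

Lemma interpolable_quadratic (L : R) (I : Type) (x : I -> E) (g : I -> Es)
    (f : I -> R) (F : E -> R) :
  (forall y, exists s : Es, forall h,
    `|F (y + h) - F y - p s h| <= L / 2 * primal_norm B h ^+ 2) ->
  (forall i h,
    `|F (x i + h) - f i - p (g i) h| <= L / 2 * primal_norm B h ^+ 2) ->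
  interpolable B L x g f.
Proof.
move=> Fsmooth Fx; exists F.
  split=> [y|y z]; have [s Fs] := Fsmooth y;
      have [dF gF] := differentiable_quadratic p_nondeg B F y s _ Fs => //.
  have := Fs (z - y); rewrite gF subrKC primal_normB => Fz.
  have -> : F y + p s (z - y) - F z = - (F z - F y - p s (z - y)).
    by move: (p s (z - y)) => q; ring.
  by rewrite normrN.
(* The case [h = 0] of [Fx] gives the value; the quadratic error then identifies the gradient. *)
move=> i; have Fxi : F (x i) = f i.
  have := Fx i 0; rewrite addr0 linear0r subr0 primal_norm_sqr linear0r mulr0.
  by rewrite normr_le0 subr_eq0 => /eqP.
split=> //.
apply: (differentiable_quadratic p_nondeg B F (x i) (g i) (L / 2) _).2 => h.
by rewrite Fxi.
Qed.
End smooth.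

Theorem theorem3p10 (R : realType) (E Es : vectType R) (p : pairing Es E)
    (p_nondeg : nondegenerate_pairing p) (B : spd_operator p)
    (L : R) (L_gt0 : 0 < L) (I : Type)
    (x : I -> E) (g : I -> Es) (f : I -> R) :
  interpolable B L x g f <->
  forall i j : I,
    f i >= f j - L / 4 * primal_norm B (x i - x j) ^+ 2
           - 1 / 2 * p (g i + g j) (x j - x i)
           + 1 / (4 * L) * dual_norm B (g i - g j) ^+ 2.
Proof.
split=> [[F [_ Fs] Fx] i j|ineq].
  have bnd k z : parabola B (- L) (x k) (g k) (f k) z <= F z <=
      parabola B L (x k) (g k) (f k) z.
    have := Fs (x k) z; have [-> ->] := Fx k.
    rewrite primal_normB primal_norm_sqr /parabola.
    move: (p (B _) _) (p (g k) _) => n q; rewrite ler_norml => /andP[? ?].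
    by apply/andP; split; lra.
  apply/(parabola_leP B p_nondeg) => // z.
  by have /andP[_ /(le_trans _)->] := bnd i z; have /andP[] := bnd j z.
(* The envelope needs an index; with no data, the zero function interpolates. *)
have [[i0 _]|I0] := pselect (exists i : I, True); last first.
  apply: (interpolable_quadratic p_nondeg _ _ _ _ _ _ (fun=> 0)) => [y|i].
    exists 0 => h; rewrite linear0l !subr0 normr0.
    by rewrite mulr_ge0 ?sqr_ge0// divr_ge0 ?ltW.
  by case: I0; exists i.
have lu i j z := (parabola_leP B p_nondeg L _ _ _ _ _ _ L_gt0).2 (ineq i j) z.
pose F := envelope B L x g f.
apply: (interpolable_quadratic p_nondeg _ _ _ _ _ _ F).
  apply: semiconvex_smooth => //; first exact: ltW.
    exact: envelope_semiconvex.
  exact: envelope_second_difference.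
move=> i h.
(* At [x i] the two paraboloids of index [i] share value and slope, so they trap [F] within
   [L / 2 * N h] of its linear model. *)
have Fl : parabola B (- L) (x i) (g i) (f i) (x i + h) <= F (x i + h).
  by apply: le_envelope => //; exact: lower_admissible.
have Fu : F (x i + h) <= parabola B L (x i) (g i) (f i) (x i + h).
  by apply: envelope_le => // psi [].
move: Fl Fu; rewrite /parabola (addrAC (x i)) subrr add0r primal_norm_sqr.
move: (p (B h) h) (p (g i) h) (F _) => n q r Fl Fu.
by rewrite ler_norml; apply/andP; split; lra.
Qed.
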